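(* For every integer $n\ge 0$, the polynomials $P_n$ satisfy the recurrence relation $$P_{n+1}(x)=\sum_{i=0}^{n}\sum_{j=0}^{i}\binom{n}{i}\binom{i}{j}P_{n-i-1}(x)\,P_{i-j}(x)\,P_j(x).$$
   Context: The polynomials $P_n(x)$, $n\ge 0$, are defined by $P_0(x)=1$ and $P_n(x)=P_{n-1}'(x)+n x P_{n-1}(x)$ for $n\ge 1$. In addition $P_{-1}(x)=x$ (this occurs in the terms with $i=n$). *)

(* Defs.v *)
From mathcomp Require Import all_boot all_order all_algebra.

Set Implicit Arguments.
Unset Strict Implicit.
Unset Printing Implicit Defensive.

Import GRing.Theory.
Local Open Scope ring_scope.

Fixpoint Pnat (R : comNzRingType) (n : nat) : {poly R} :=
  if n is m.+1 then (Pnat R m)^`() + m.+1%:R *: 'X * Pnat R m else 1.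

(* The index is an integer because P_{-1} = 'X is also needed; the value 0    *)
(* for indices below -1 is a junk value.                                      *)
Definition P (R : comNzRingType) (k : int) : {poly R} :=
  match k with
  | Posz n => Pnat R n
  | Negz 0 => 'X
  | Negz _.+1 => 0
  end.

(* Main.v *)
Require Import Defs.
From mathcomp Require Import all_boot all_order all_algebra.
From mathcomp Require Import ring.

(* Put f = exp(x^2/2) and let x be a function of y with dx/dy = f(x). Then      *)
(* d^m x/dy^m = f^m P_{m-1} for all m >= 0, including m = 0 where P_{-1} = x.  *)
(* Since x'' = x x' x', the recurrence is the n-th derivative of this product  *)
(* by Leibniz' rule, after dividing by f^(n+2). Algebraically, d/dy acts on    *)
(* the coefficient q of f^k as q |-> q' + k x q.                               *)

Set Implicit Arguments.
Unset Strict Implicit.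
Unset Printing Implicit Defensive.

Import GRing.Theory.
Local Open Scope ring_scope.

(** A [wderiv_seq] is determined by its first term, and [binom_conv_wderiv] makes such sequences
    closed under binomial convolution, with weights adding. So both sides of the recurrence are
    sequences of weight 2, and they agree at index 0. *)

Section WeightedDerivative.

Variable R : comNzRingType.
Implicit Types (p q : {poly R}) (a b : nat -> {poly R}).

Definition wderiv (k : nat) p := p^`() + k%:R * 'X * p.

Lemma wderivM k l p q :
  wderiv (k + l) (p * q) = wderiv k p * q + p * wderiv l q.
Proof. by rewrite /wderiv derivM natrD; ring. Qed.

Lemma wderiv_sum (I : Type) (r : seq I) (F : I -> {poly R}) k :
  wderiv k (\sum_(i <- r) F i) = \sum_(i <- r) wderiv k (F i).
Proof. by rewrite /wderiv raddf_sum mulr_sumr big_split. Qed.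

Lemma wderivMnat k m p : wderiv k (m%:R * p) = m%:R * wderiv k p.
Proof. by rewrite /wderiv !mulr_natl derivMn mulrnDl mulrnAr. Qed.

(** Here [a i] is the coefficient of f^(i+k) in the i-th y-derivative of f^k [a 0]; each derivative
    contributes one factor f. *)
Definition wderiv_seq (k : nat) a := forall i, a i.+1 = wderiv (i + k) (a i).

Definition binom_conv a b (n : nat) :=
  \sum_(0 <= i < n.+1) 'C(n, i)%:R * a (n - i)%N * b i.

(** Pascal's rule, regrouped so that each summand is ready for the product rule. *)
Lemma binom_convS a b n :
  binom_conv a b n.+1 = \sum_(0 <= i < n.+1)
    'C(n, i)%:R * (a (n - i).+1 * b i + a (n - i)%N * b i.+1).
Proof.
rewrite /binom_conv big_nat_recl // bin0 mul1r subn0.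
under eq_bigr => i _ do rewrite binS natrD mulrDl mulrDl subSS.
rewrite big_split /= addrA.
under [RHS]eq_bigr => i _ do rewrite mulrDr !mulrA.
rewrite [RHS]big_split /=; congr (_ + _).
rewrite big_nat_recr //= bin_small // mul0r mul0r addr0.
rewrite [RHS]big_nat_recl // bin0 mul1r subn0; congr (_ + _).
by apply: eq_big_nat => i /andP[_ lt_in]; rewrite subnSK.
Qed.

Lemma binom_conv_wderiv k l a b :
  wderiv_seq k a -> wderiv_seq l b -> wderiv_seq (k + l) (binom_conv a b).
Proof.
move=> aS bS n; rewrite binom_convS wderiv_sum.
apply: eq_big_nat => i /andP[_ /[!ltnS] le_in].
(* The total weight does not depend on [i], so [wderivM] applies to every term. *)
have -> : (n + (k + l) = (n - i + k) + (i + l))%N by rewrite addnACA subnK.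
by rewrite -mulrA wderivMnat wderivM aS bS.
Qed.

Definition shiftP (m : nat) : {poly R} := P R (m%:Z - 1).

Lemma shiftPS m : shiftP m.+1 = Pnat R m.
Proof. by rewrite /shiftP -addn1 PoszD addrK. Qed.

Lemma shiftP_wderiv : wderiv_seq 0 shiftP.
Proof.
case=> [|m]; first by rewrite shiftPS /wderiv derivX !mul0r addr0.
by rewrite !shiftPS addn0 /wderiv /= mulr_natl scaler_nat.
Qed.

End WeightedDerivative.

Theorem proposition9 (R : comNzRingType) (n : nat) :
  P R (n%:Z + 1) =
    \sum_(0 <= i < n.+1) \sum_(0 <= j < i.+1)
      'C(n, i)%:R * 'C(i, j)%:R *
      P R (n%:Z - i%:Z - 1) * P R (i%:Z - j%:Z) * P R j%:Z.
Proof.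
pose u := shiftP R; pose v m := u m.+1.
have uS : wderiv_seq 0 u := @shiftP_wderiv R.
have vS : wderiv_seq 1 v by move=> i; rewrite /v uS addn0 addn1.
have cS := binom_conv_wderiv uS (binom_conv_wderiv vS vS).
(* This is x'' = x x' x' differentiated [m] times; the base case is P_1 = x. *)
have uE m : u m.+2 = binom_conv u (binom_conv v v) m.
  elim: m => [|m IHm]; last by rewrite cS -IHm uS addn0 addn2.
  rewrite /binom_conv !big_nat1 /v /u !shiftPS /= derivC.
  by rewrite !mul1r !mulr1 add0r scale1r.
rewrite -PoszD addn1 -[LHS]shiftPS [LHS]uE.
apply: eq_big_nat => i /andP[_ /[!ltnS] le_in]; rewrite mulr_sumr.
apply: eq_big_nat => j /andP[_ /[!ltnS] le_ji].
rewrite (subzn le_in) (subzn le_ji) /v /u !shiftPS /shiftP /=.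
ring.
Qed.
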